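(* Let $p\ge 1$ be an integer, let $\alpha$ be the zero of the polynomial $X^p-X^{p-1}-\cdots-X-1$ in $[1,2)$, and let $B=(\beta_{p-1},\ldots,\beta_0)$ be an alternate base such that $\beta_i>\alpha$ for every $i$. Then no other alternate base of length $p$ has the same list of greedy (resp. quasi-greedy) expansions of $1$. That is, if $\Gamma$ is an alternate base of length $p$ such that for every $i\in\{0,\ldots,p-1\}$ the greedy $S^i(\Gamma)$-expansion of $1$ equals the greedy $S^i(B)$-expansion of $1$, then $\Gamma=B$; and likewise with ''greedy'' replaced by ''quasi-greedy'' throughout.
   Context: A Cantor real base is a bi-infinite sequence $B=(\beta_n)_{n\in\mathbb{Z}}$ of real numbers $\beta_n>1$ with $\prod_{n=1}^{+\infty}\beta_n=\prod_{n=1}^{+\infty}\beta_{-n}=+\infty$. For $n\in\mathbb{Z}$, $S^n(B)=(\beta_{m+n})_{m\in\mathbb{Z}}$. For a one-sided infinite sequence $\mathbf{a}=a_1a_2\cdots$ of non-negative integers, $\mathrm{val}_{S^n(B)}(0\bullet\mathbf{a})=\sum_{j=1}^{+\infty}\frac{a_j}{\beta_{n-1}\beta_{n-2}\cdots\beta_{n-j}}$. An alternate base of length $p\ge 1$ is a Cantor real base $B$ with $S^p(B)=B$ (i.e. $p$-periodic; $p$ need not be the least period); it is written $B=(\beta_{p-1},\ldots,\beta_0)$. For $n\in\mathbb{Z}$, the greedy $S^n(B)$-expansion of $1$ is the lexicographically greatest infinite sequence $\mathbf{t}$ of non-negative integers with $\mathrm{val}_{S^n(B)}(0\bullet\mathbf{t})=1$.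 The quasi-greedy $S^n(B)$-expansion of $1$ is the lexicographically greatest infinite sequence $\mathbf{d}$ of non-negative integers, not ending in a tail of zeros, with $\mathrm{val}_{S^n(B)}(0\bullet\mathbf{d})=1$. *)

(* Defs.v *)
From mathcomp Require Import all_boot all_order all_algebra.
From mathcomp Require Import all_classical all_reals all_analysis.

Set Implicit Arguments.
Unset Strict Implicit.
Unset Printing Implicit Defensive.
Import Order.TTheory GRing.Theory Num.Theory.
Import numFieldNormedType.Exports.

Local Open Scope classical_set_scope.
Local Open Scope ring_scope.

Section CantorRealBases.
Context {R : realType}.
Implicit Type B : int -> R.

Definition cantor_real_base B : Prop :=
  [/\ forall n : int, 1 < B n,
      (fun N : nat => \prod_(1 <= n < N.+1) B n%:Z) @ \oo --> +oo &
      (fun N : nat => \prod_(1 <= n < N.+1) B (- n%:Z)) @ \oo --> +oo].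

Definition base_shift (n : int) B : int -> R := fun m => B (m + n).

(* The base B = (B (p - 1), ..., B 0); p need not be the least period. *)
Definition alternate_base (p : nat) B : Prop :=
  cantor_real_base B /\ base_shift p%:Z B = B.

(* The sequence a_1 a_2 a_3 ... is represented by a with a j = a_(j+1); it is
   compared lexicographically through the order of big_lexi_order. *)
Definition digits : Type := big_lexi_order (fun _ : nat => nat).

(* val_B(0 . a) = sum_(j >= 1) a_j / (B_(-1) * ... * B_(-j)), a sum of
   nonnegative terms, equal to +oo when it diverges. *)
Definition base_val B (a : digits) : \bar R :=
  (\sum_(0 <= j <oo)
     ((a j)%:R / \prod_(1 <= k < j.+2) B (- k%:Z))%:E)%E.

Definition ends_in_zeros (a : digits) : Prop :=
  exists N : nat, forall j : nat, (N <= j)%N -> a j = 0%N.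

(* The lexicographically greatest element of A; the zero sequence is a dummy
   value for sets A without a greatest element. *)
Definition lex_greatest (A : set digits) : digits :=
  xget ((fun=> 0%N) : digits) [set t | A t /\ ubound A t].

Definition greedy_expansion1 B : digits :=
  lex_greatest [set a | base_val B a = 1%E].

Definition quasi_greedy_expansion1 B : digits :=
  lex_greatest [set a | base_val B a = 1%E /\ ~ ends_in_zeros a].

End CantorRealBases.

(* Main.v *)
Require Import Defs.
From mathcomp Require Import all_boot all_order all_algebra.
From mathcomp Require Import all_classical all_reals all_analysis.
From mathcomp Require Import ring lra zify.
Import Order.TTheory GRing.Theory Num.Theory.
Import numFieldNormedType.Exports.
Local Open Scope classical_set_scope.
Local Open Scope ring_scope.

(* Write w_i(n) for the value of a digit 1 at place n in the base S^i(B). The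
   greedy and quasi-greedy expansions both leave, after n digits, a remainder
   between 0 and w_i(n). The condition on alpha says that
   w_i(1) + ... + w_i(p) < 1 for all i; hence both expansions of 1 in S^i(B)
   are lexicographically at least 1^p 0 0 ..., which forces the same strict
   inequality for Gamma. The roles of B and Gamma are now symmetric. Let
   lambda > 1 be the largest of all ratios B_j / Gamma_j and Gamma_j / B_j, say
   lambda = B_i / Gamma_i. From w_{i+1}(n-1) to w_{i+1}(n), the ratio of the
   weights for Gamma to those for B is multiplied by lambda when n = 1 mod p,
   and by at least 1/lambda otherwise. The gain at n = 1 outweighs all the
   losses because the sum of the w_{i+1}(n) over the n not divisible by p is
   < 1, so the value in Gamma would exceed 1. *)

(** * Weights of places, remainders and values of words of ones *)

Section Weights.
Context {R : realType}.
Implicit Types (b g : nat -> R) (a : nat -> nat).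

Definition weight b n : R := \prod_(k < n) (b k)^-1.

Definition remainder b a n : R := 1 - \sum_(j < n) (a j)%:R * weight b j.+1.

Definition ones b m : R := \sum_(n < m) weight b n.+1.

(** Both bounds are weak so that one notion covers both expansions: the greedy one has a strict
    upper bound for n > 0, the quasi-greedy one a strict lower bound. Everything up to the
    injectivity result uses only this. *)
Definition tight b a := forall n, 0 <= remainder b a n <= weight b n.

Lemma weight0 b : weight b 0 = 1.
Proof. by rewrite /weight big_ord0. Qed.

Lemma weightS b n : weight b n.+1 = weight b n * (b n)^-1.
Proof. by rewrite /weight big_ord_recr. Qed.

Lemma weightD b k n :
  weight b (k + n) = weight b k * weight (fun j => b (k + j)%N) n.
Proof. by rewrite /weight big_split_ord. Qed.

Lemma remainder0 b a : remainder b a 0 = 1.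
Proof. by rewrite /remainder big_ord0 subr0. Qed.

Lemma remainderS b a n :
  remainder b a n.+1 = remainder b a n - (a n)%:R * weight b n.+1.
Proof. by rewrite /remainder big_ord_recr opprD addrA. Qed.

Lemma onesS b m : ones b m.+1 = ones b m + weight b m.+1.
Proof. by rewrite /ones big_ord_recr. Qed.

Lemma onesD b k m :
  ones b (k + m) = ones b k + weight b k * ones (fun j => b (k + j)%N) m.
Proof.
rewrite /ones big_split_ord /=; congr (_ + _).
by rewrite mulr_sumr; apply: eq_bigr => i _; rewrite -addnS weightD.
Qed.

Lemma eq_remainder b a a' n :
  (forall j, (j < n)%N -> a j = a' j) -> remainder b a n = remainder b a' n.
Proof.
by move=> e; congr (_ - _); apply: eq_bigr => j _; rewrite e.
Qed.

Lemma remainder_ones b a m :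
  (forall j, (j < m)%N -> a j = 1%N) -> remainder b a m = 1 - ones b m.
Proof.
by move=> a1; congr (_ - _); apply: eq_bigr => j _; rewrite a1// mul1r.
Qed.

Section Positive.
Context {b : nat -> R} (b_gt0 : forall n, 0 < b n).

Lemma weight_gt0 n : 0 < weight b n.
Proof. by apply: prodr_gt0 => k _; rewrite invr_gt0. Qed.

Lemma remainder_le a m n : (m <= n)%N -> remainder b a n <= remainder b a m.
Proof.
move=> /subnK <-; elim: (n - m)%N => // k; rewrite addSn remainderS.
by apply: le_trans; rewrite gerBl mulr_ge0// ltW// weight_gt0.
Qed.

Lemma ones_le m n : (m <= n)%N -> ones b m <= ones b n.
Proof.
move=> /subnK <-; elim: (n - m)%N => // k IH; rewrite addSn onesS.
by rewrite ler_wpDr// ltW// weight_gt0.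
Qed.

End Positive.

Section BoundedBelow.
Context {b : nat -> R} {c : R} (c_gt1 : 1 < c) (b_ge : forall n, c <= b n).

Let b_gt0 n : 0 < b n.
Proof. by rewrite (lt_le_trans _ (b_ge n))// (lt_trans _ c_gt1). Qed.

Lemma weight_cvg0 : weight b n @[n --> \oo] --> 0.
Proof.
have c0 : 0 < c by rewrite (lt_trans _ c_gt1).
apply: (@squeeze_cvgr _ _ _ _ (fun=> 0) (fun n => c^-1 ^+ n)).
- apply: nearW => n; rewrite ltW ?weight_gt0//=.
  rewrite /weight -[leRHS]mulr1 -[n in c^-1 ^+ n]card_ord -prodr_const mulr1.
  apply: ler_prod => k _; rewrite invr_ge0 ltW//=.
  by rewrite lef_pV2// posrE.
- exact: cvg_cst.
- by apply: cvg_expr; rewrite gtr0_norm ?invr_gt0// invf_lt1.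
Qed.

Lemma weight_small e : 0 < e -> exists n, weight b n < e.
Proof.
move=> e0; have [n _ /(_ n (leqnn n))] := cvgr0_norm_lt _ weight_cvg0 _ e0.
by move=> /ltr_normlW ?; exists n.
Qed.

(** If all digits from n on vanished, the remainder would stay constant and positive while being
    bounded by weights that tend to 0. *)
Lemma tight_nonzero_digit a n : tight b a -> 0 < remainder b a n ->
  exists2 j, (n <= j)%N & (0 < a j)%N.
Proof.
move=> tba r0; apply: contrapT => noj.
have rE k : remainder b a (k + n) = remainder b a n.
  elim: k => // k <-; rewrite addSn remainderS; case: (posnP (a (k + n)%N)).
    by move=> ->; rewrite mul0r subr0.
  by move=> ak; case: noj; exists (k + n)%N; rewrite ?leq_addl.
have [k] := weight_small _ r0; apply/negP; rewrite -leNgt -(rE k).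
rewrite (le_trans (remainder_le b_gt0 _ _ _ (leq_addr n k)))//.
by have /andP[] := tba k.
Qed.

End BoundedBelow.

End Weights.

(** * Comparison of two bases at an extremal ratio *)

Section Comparison.
Context {R : realType} {p : nat} (p_gt0 : (0 < p)%N).
Implicit Types (b g : nat -> R) (a : nat -> nat).

Definition offsum (f : nat -> R) N : R := \sum_(n < N | ~~ (p %| n)%N) f n.

Lemma offsumS f N :
  offsum f N.+1 = offsum f N + (if (p %| N)%N then 0 else f N).
Proof.
by rewrite /offsum big_mkcond big_ord_recr /= -big_mkcond /=; case: (p %| N)%N.
Qed.

Lemma offsum_le (f : nat -> R) m n :
  (forall k, 0 <= f k) -> (m <= n)%N -> offsum f m <= offsum f n.
Proof.
move=> f0 /subnK <-; elim: (n - m)%N => // k IH; rewrite addSn offsumS.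
by rewrite ler_wpDr//; case: ifP.
Qed.

Section Periodic.
Context {b : nat -> R} (b_gt0 : forall n, 0 < b n).
Context (b_per : forall n, b (p + n)%N = b n) (ones_lt1 : ones b p < 1).

Lemma offsum_period : offsum (weight b) p + weight b p = ones b p.
Proof.
have [q pE] : exists q, p = q.+1 by exists p.-1; rewrite prednK.
rewrite pE onesS; congr (_ + _).
rewrite /offsum big_mkcond big_ord_recl /= dvdn0 add0r.
by apply: eq_bigr => i _; rewrite gtnNdvd// pE ltnS.
Qed.

Lemma offsum_weightD N :
  offsum (weight b) (p + N) =
  offsum (weight b) p + weight b p * offsum (weight b) N.
Proof.
rewrite /offsum big_mkcond big_split_ord /= -big_mkcond /=; congr (_ + _).
rewrite [in RHS]big_mkcond mulr_sumr; apply: eq_bigr => i _ /=.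
rewrite dvdn_addr// weightD (_ : (fun j => _) = b); last exact/funext.
by case: ifP; rewrite ?mulr0.
Qed.

(** Splitting off one period at a time bounds the sums by the geometric series c + c w + c w^2 + ...
    = c / (1 - w), with c the sum over the first period and w = [weight b p]. It is < 1 because c +
    w = [ones b p] < 1. *)
Lemma offsum_bounded : exists2 s, s < 1 & forall N, offsum (weight b) N <= s.
Proof.
have w0 n := weight_gt0 b_gt0 n.
have := offsum_period; set c := offsum _ p => cw.
have c0 : 0 <= c by apply: sumr_ge0 => i _; exact: ltW.
have wp := w0 p; have cw1 : c + weight b p < 1 by rewrite cw.
have p1 : 0 < 1 - weight b p by lra.
exists (c / (1 - weight b p)); first by rewrite ltr_pdivrMr//; lra.
move=> N; rewrite ler_pdivlMr//; have [n] := ubnP N.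
elim: n N => // n IH N Nn.
have [Np|pN] := leqP N p.
  have : offsum (weight b) N <= c by apply: offsum_le => // k; exact: ltW.
  have : 0 <= offsum (weight b) N by apply: sumr_ge0 => i _; exact: ltW.
  nra.
rewrite -(subnKC (ltnW pN)) offsum_weightD -/c.
have := IH (N - p)%N ltac:(lia); nra.
Qed.

End Periodic.

(* Abel summation of [sum_n a_n * weight g n.+1 <= 1], where [weight g n] is at
   least [h n * weight b n] for a function [h] with [h 1 = lam] that drops by
   [lam - 1] right after each index not divisible by [p]. *)
Lemma extremal_ratio_absurd b g a (c lam : R) :
  1 < c -> (forall n, c <= b n) -> (forall n, b (p + n)%N = b n) ->
  ones b p < 1 -> tight b a ->
  (forall n, 0 < g n) -> (forall n, 0 <= remainder g a n) ->
  1 < lam -> (forall n, g n <= lam * b n) ->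
  (forall n, (p %| n)%N -> g n = b n / lam) -> False.
Proof.
move=> c1 bc b_per ones1 tba g0 rg lam1 glam gdvd.
have b0 n : 0 < b n by rewrite (lt_le_trans _ (bc n))// (lt_trans _ c1).
have wb0 n := weight_gt0 b0 n; have wg0 n := weight_gt0 g0 n.
have lam0 : 0 < lam by lra.
pose C := offsum (fun=> 1).
have C0 n : 0 <= C n by apply: sumr_ge0.
have CS n : C n.+1 = C n + (if (p %| n)%N then 0 else 1) := offsumS _ n.
pose h n := 1 + (lam - 1) * (1 - C n).
have muE n : (p %| n)%N -> b n / g n = lam.
  by move=> pn; rewrite gdvd// invf_div mulrCA divff ?mulr1// gt_eqF.
have hg n : h n.+1 * weight b n.+1 <= weight g n.+1.
  rewrite -ler_pdivlMr//; elim: n => [|n].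
    rewrite /h /C offsumS dvdn0 /offsum big_ord0 !weightS !weight0.
    by rewrite !mul1r invrK [_ * b _]mulrC muE ?dvdn0//; lra.
  set x := _ / _ => IH.
  have x0 : 0 < x by rewrite divr_gt0.
  pose mu := b n.+1 / g n.+1.
  rewrite (weightS g) (weightS b) invfM invrK mulrACA -/x [_ * b _]mulrC -/mu.
  have [pn|pn] := boolP (p %| n.+1)%N.
    by rewrite /mu muE//; move: IH; rewrite /h (CS n.+1) pn addr0; nra.
  have lmu : lam^-1 <= mu by rewrite /mu ler_pdivlMr// mulrC ler_pdivrMr// mulrC.
  apply: (@le_trans _ _ (x / lam)); last by rewrite ler_wpM2l// ltW.
  rewrite ler_pdivlMr//; move: IH; rewrite /h (CS n.+1) (negbTE pn).
  have := C0 n.+1; move: (C _) => y y0 IH.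
  (* If x > lam, then x / lam > 1, while the new value of [h] is at most 1. If x <= lam, dividing by
     lam lowers x by at most lam - 1, which is the drop of [h]. *)
  have [xl|xl] := lerP x lam; last first.
    have : 0 <= (lam - 1) * y by rewrite mulr_ge0//; lra.
    nra.
  have : 1 + (lam - 1) * (1 - (y + 1)) <= x - (lam - 1) by lra.
  nra.
have abel N : lam - (lam - 1) * offsum (weight b) N <=
    \sum_(n < N) (a n)%:R * weight g n.+1 + h N * remainder b a N.
  elim: N => [|N IH].
    by rewrite /h /C /offsum !big_ord0 remainder0; lra.
  rewrite big_ord_recr /=.
  have aE : (a N)%:R * weight b N.+1 = remainder b a N - remainder b a N.+1.
    by rewrite remainderS; ring.
  have : h N.+1 * (remainder b a N - remainder b a N.+1) <= (a N)%:R * weight g N.+1.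
    by rewrite -aE mulrCA ler_wpM2l.
  (* A drop of [h] costs (lam - 1) times the remainder, hence at most [(lam - 1) * weight b N] by
     tightness. *)
  have /andP[r0 rw] := tba N.
  move: IH; rewrite /h CS [offsum _ N.+1]offsumS.
  by case: ifP => _; nra.
have [s s1 sP] := offsum_bounded b0 b_per ones1.
(* The left side of [abel] is at least 1 + (lam - 1) (1 - s), and the right side at most
   [1 + lam * weight b N]. This threshold makes the two incompatible. *)
have e0 : 0 < (lam - 1) * (1 - s) / lam by rewrite divr_gt0// mulr_gt0//; lra.
have [N wN] := weight_small c1 bc _ e0.
have /andP[r0 rw] := tba N.
have lamB1 : 0 <= lam - 1 by lra.
have := abel N; have := ler_wpM2l lamB1 (sP N); have := rg N.
rewrite {1}/remainder.
have hl : h N <= lam by rewrite /h; have := C0 N; nra.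
have : h N * remainder b a N <= lam * weight b N.
  by rewrite (le_trans (ler_wpM2r r0 hl))// ler_wpM2l// ltW.
move: wN; rewrite ltr_pdivlMr//; lra.
Qed.

End Comparison.

(** * Periodic functions on the integers *)

Lemma periodic_mulz (T : Type) (p : int) (F : int -> T) (k i : int) :
  (forall i, F (i + p) = F i) -> F (i + k * p) = F i.
Proof.
move=> Fp; elim/int_ind: k => [|n IH|n IH]; first by rewrite mul0r addr0.
  by rewrite -addn1 PoszD mulrDl mul1r addrA Fp.
by rewrite -Fp -addrA; rewrite -addn1 PoszD opprD mulrDl mulN1r addrNK.
Qed.

Lemma periodic_ord (T : Type) (p : nat) (F : int -> T) (i : int) :
  (0 < p)%N -> (forall i, F (i + p%:Z) = F i) ->
  exists2 j, (j < p)%N & F i = F j%:Z.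
Proof.
move=> p0 Fp; have pN0 : p%:Z != 0 by rewrite eqz_nat -lt0n.
exists `|(i %% p%:Z)%Z|%N.
  by rewrite -ltz_nat gez0_abs ?modz_ge0// ltz_pmod.
rewrite gez0_abs ?modz_ge0// {1}(divz_eq i p%:Z) addrC.
exact: periodic_mulz.
Qed.

(** * All shifts of a base at once: transfer of the bound on ones, and injectivity *)

Section Families.
Context {R : realType}.
Implicit Types (B G : int -> R) (a : int -> nat -> nat).

(* The bases dividing successive digits of an expansion in [base_shift i B]. *)
Definition past B (i : int) : nat -> R := fun n => B (i - n.+1%:Z).

Lemma pastD B i k : (fun n => past B i (k + n)%N) = past B (i - k%:Z).
Proof.
by apply/funext => n; rewrite /past -addnS PoszD opprD addrA.
Qed.

(** Induction on m for all shifts simultaneously, according to the first digit different from 1: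
    after a digit at least 2, the remaining ones are the same problem in a shifted base with a
    smaller m. *)
Lemma ones_lt1_transfer B G a p (c : R) :
  1 < c -> (forall i, c <= B i) -> (forall i, 0 < G i) ->
  (forall i, ones (past B i) p < 1) ->
  (forall i, tight (past B i) (a i)) ->
  (forall i n, 0 <= remainder (past G i) (a i) n) ->
  forall m i, (m <= p)%N -> ones (past G i) m < 1.
Proof.
move=> c1 cB G0 onesB tB rG m; have [N] := ubnP m.
elim: N m => // N IH m mN i mp.
have bB n : c <= past B i n by apply: cB.
have b0 n : 0 < past B i n by rewrite (lt_le_trans _ (bB n))// (lt_trans _ c1).
have g0 n : 0 < past G i n by apply: G0.
have oB k : (k <= p)%N -> ones (past B i) k < 1.
  by move=> kp; rewrite (le_lt_trans _ (onesB i))// ones_le.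
have [[k]|] := pselect (exists k, (k < m)%N && (a i k != 1%N)); last first.
  move=> all1; have a1 j : (j < m)%N -> a i j = 1%N.
    by move=> jm; apply/eqP/negPn/negP => aj; apply: all1; exists j; rewrite jm.
  (* In B the word of m ones leaves a positive remainder, so some later digit is nonzero; in G that
     digit needs room beyond the m ones. *)
  have [j mj aj] : exists2 j, (m <= j)%N & (0 < a i j)%N.
    apply: (tight_nonzero_digit c1 bB _ _ (tB i)).
    by rewrite remainder_ones// subr_gt0 oB.
  have w0 : 0 < (a i j)%:R * weight (past G i) j.+1.
    by rewrite mulr_gt0 ?ltr0n// weight_gt0.
  have := rG i j.+1; have := remainder_le g0 (a i) _ _ mj.
  rewrite remainderS (remainder_ones _ _ m)//; lra.
move=> /(ex_intro (fun k => (k < m)%N && (a i k != 1%N)) k) /ex_minnP[{}k].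
move=> /andP[km ak] kmin.
have a1 j : (j < k)%N -> a i j = 1%N.
  move=> jk; apply/eqP/negPn/negP => aj.
  by have := kmin j; rewrite aj (ltn_trans jk km) => /(_ isT); rewrite leqNgt jk.
(* A digit 0 after k ones would, by tightness in B, give [ones (past B i) k.+1] >= 1. *)
have [ak0|ak0] := posnP (a i k).
  have /andP[_] := tB i k.+1.
  rewrite remainderS ak0 mul0r subr0 remainder_ones// lerBlDr addrC -onesS.
  by rewrite leNgt oB// (leq_trans km).
have ak2 : (2 <= a i k)%N by rewrite ltn_neqAle eq_sym ak.
have := rG i k.+1; rewrite remainderS remainder_ones//.
have w0 := weight_gt0 g0 k.+1.
have : 2%:R * weight (past G i) k.+1 <= (a i k)%:R * weight (past G i) k.+1.
  by rewrite ler_wpM2r ?ler_nat// ltW.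
(* One of the two units at place k + 1 pays for the one there; by induction the other exceeds the
   value of all the following ones. *)
rewrite -(subnKC km) onesD onesS pastD.
have := IH (m - k.+1)%N ltac:(lia) (i - k.+1%:Z) ltac:(lia); nra.
Qed.

Lemma periodic_gt1_bounded B p : (0 < p)%N ->
  (forall i, B (i + p%:Z) = B i) -> (forall i, 1 < B i) ->
  exists2 c, 1 < c & forall i, c <= B i.
Proof.
move=> p0 Bp B1; exists (\big[Num.min/2]_(j < p) B j%:Z).
  by elim/big_ind: _ => [|x y x1 y1|//]; rewrite ?ltr1n// lt_min x1.
move=> i; have [j jp ->] := periodic_ord _ _ _ i p0 Bp.
exact: (bigmin_le_cond _ (j := Ordinal jp)).
Qed.

Lemma tight_family_inj B G a p : (0 < p)%N ->
  (forall i, B (i + p%:Z) = B i) -> (forall i, G (i + p%:Z) = G i) ->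
  (forall i, 1 < B i) -> (forall i, 1 < G i) ->
  (forall i, ones (past B i) p < 1) ->
  (forall i, tight (past B i) (a i)) -> (forall i, tight (past G i) (a i)) ->
  G = B.
Proof.
move=> p0 Bp Gp B1 G1 onesB tB tG.
have [c c1 cB] := periodic_gt1_bounded _ _ p0 Bp B1.
have [c' c'1 cG] := periodic_gt1_bounded _ _ p0 Gp G1.
have B0 i : 0 < B i by apply: lt_trans (B1 i).
have G0 i : 0 < G i by apply: lt_trans (G1 i).
have rem0 (F : int -> R) i : tight (past F i) (a i) ->
    forall n, 0 <= remainder (past F i) (a i) n.
  by move=> tF n; have /andP[] := tF n.
have onesG i : ones (past G i) p < 1.
  apply: (ones_lt1_transfer B G a p c c1 cB) => // j n; exact: rem0.
have pastp (F : int -> R) i n : (forall i, F (i + p%:Z) = F i) ->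
    past F i (p + n)%N = past F i n.
  by move=> Fp; rewrite -[LHS]Fp /past; congr F; lia.
(* The shift by i + 1 puts the base with index i at the places n divisible by p, starting with n =
   0, as [extremal_ratio_absurd] requires. *)
have past0 (F : int -> R) i n : (forall i, F (i + p%:Z) = F i) ->
    (p %| n)%N -> past F (i + 1) n = F i.
  move=> Fp /dvdnP[k ->]; rewrite /past -(periodic_mulz _ p%:Z F k%:Z)//.
  by congr F; lia.
have noratio (F H : int -> R) (c0 lam : R) i :
    1 < c0 -> (forall i, c0 <= F i) -> (forall i, 0 < H i) ->
    (forall i, F (i + p%:Z) = F i) -> (forall i, H (i + p%:Z) = H i) ->
    (forall i, ones (past F i) p < 1) ->
    (forall i, tight (past F i) (a i)) -> (forall i, tight (past H i) (a i)) ->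
    (forall j, H j <= lam * F j) -> 1 < lam -> F i / H i = lam -> False.
  move=> c01 cF H0 Fp Hp oF tF tH Hlam lam1 iE.
  apply: (extremal_ratio_absurd p0 (past F (i + 1)) (past H (i + 1))
    (a (i + 1)) c0 lam) => //.
  - by move=> n; apply: cF.
  - by move=> n; apply: pastp.
  - by move=> n; apply: H0.
  - exact: rem0.
  - by move=> n; apply: Hlam.
  - move=> n pn; rewrite !past0// -iE invf_div mulrCA divff ?mulr1//.
    by rewrite gt_eqF// (lt_le_trans _ (cF i))// (lt_trans _ c01).
(* The maximum of both ratios bounds each base by a multiple of the other, so whichever ratio
   attains it, the other base can take the role of Gamma. *)
pose f i := Num.max (B i / G i) (G i / B i).
have fp i : f (i + p%:Z) = f i by rewrite /f Bp Gp.
have [i fi] : exists i, forall j, f j <= f i.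
  pose i0 := Ordinal p0.
  have [i _ imax] := @arg_maxP _ _ _ i0 xpredT (fun j : 'I_p => f j%:Z) isT.
  exists i%:Z => j; have [k kp ->] := periodic_ord _ _ _ j p0 fp.
  exact: (imax (Ordinal kp)).
have fBG j : B j <= f i * G j.
  by rewrite -ler_pdivrMr// (le_trans _ (fi j))// le_max lexx.
have fGB j : G j <= f i * B j.
  by rewrite -ler_pdivrMr// (le_trans _ (fi j))// le_max lexx orbT.
have [f1|f1] := leP (f i) 1.
  apply/funext => j; apply/eqP; rewrite eq_le.
  by rewrite (le_trans (fGB j)) ?(le_trans (fBG j))// ger_pMl.
exfalso; have [GB|GB] := leP (G i / B i) (B i / G i).
  apply: (noratio B G c (f i) i) => //.
  by rewrite /f; apply/esym/max_idPl.
apply: (noratio G B c' (f i) i) => //.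
by rewrite /f; apply/esym/max_idPr/ltW.
Qed.

(** Divide the equation for alpha by alpha^p and reverse the order of summation. *)
Lemma sum_inv_powers (p : nat) (alpha : R) :
  root ('X^p - \sum_(i < p) 'X^i : {poly R}) alpha -> 0 < alpha ->
  \sum_(n < p) alpha^-1 ^+ n.+1 = 1.
Proof.
move=> + alpha0; rewrite rootE !hornerE horner_sum subr_eq0 => /eqP alphaE.
have aN0 : alpha ^+ p != 0 by rewrite expf_neq0// gt_eqF.
apply: (mulfI aN0); rewrite mulr1 [RHS]alphaE mulr_sumr.
rewrite (reindex_inj rev_ord_inj) /=; apply: eq_bigr => i _.
rewrite subnSK// hornerXn exprVn -expfB_cond.
  by rewrite subKn// ltnW.
by rewrite gt_eqF ?add0n ?leq_subr.
Qed.

Lemma ones_past_lt1 B p (alpha : R) : (0 < p)%N ->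
  root ('X^p - \sum_(i < p) 'X^i : {poly R}) alpha -> 0 < alpha ->
  (forall i, alpha < B i) -> forall i, ones (past B i) p < 1.
Proof.
move=> p0 ralpha alpha0 aB i; rewrite -(sum_inv_powers _ _ ralpha alpha0).
apply: ltr_sum => [|n _]; first by apply/hasP; exists (Ordinal p0); rewrite ?mem_index_enum.
rewrite /weight -[X in _ ^+ X]card_ord -prodr_const.
apply: ltr_prod => [|k _]; first by apply/hasP; exists ord0; rewrite ?mem_index_enum.
have ab : alpha < past B i k by exact: aB.
have b0 := lt_trans alpha0 ab.
by rewrite invr_ge0 (ltW b0) /= ltf_pV2.
Qed.

End Families.

(** * Existence and tightness of the greedy and quasi-greedy expansions *)

Lemma lex_greatest_eq (A : set digits) (t : digits) :
  A t -> ubound A t -> lex_greatest A = t.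
Proof.
move=> At ut; apply: xget_unique => // s [As us].
by apply: le_anti; rewrite ut// us.
Qed.

Lemma digits_le (x t : digits) :
  (forall k, (forall j, (j < k)%N -> x j = t j) -> (x k <= t k)%N) ->
  (x <= t)%O.
Proof.
move=> H; rewrite leEbig_lexi_order; case E: first_diff => [n|//].
by have [pre _] := (first_diff_SomeP x t n).1 E; apply: H.
Qed.

Section Expansions.
Context {R : realType}.
Implicit Types (b : nat -> R) (B : int -> R) (a t : digits).

(** One recursion serves both expansions. The remainder divided by its weight is multiplied by the
    next base element, giving a value in [Q], and a digit is then subtracted to land in [P]. The
    conclusion starts at [n.+1] because the initial value 1 need only satisfy [Q]: in the greedy
    case it lies outside [P]. *)
Lemma digits_exist b (Q P : R -> Prop) : (forall n, 0 < b n) ->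
  (forall x, Q x -> exists d : nat, P (x - d%:R)) ->
  (forall x, P x -> Q x) -> (forall c x, 0 < c -> Q x -> Q (c * x)) -> Q 1 ->
  exists a, forall n, P (remainder b a n.+1 / weight b n.+1).
Proof.
move=> b0 QP PQ Qmul Q1.
have [d dP] : {d : R -> nat & forall x, Q x -> P (x - (d x)%:R)}.
  apply: (@choice R nat (fun x d => Q x -> P (x - d%:R))) => x.
  have [/QP[d ?]|NQ] := pselect (Q x); first by exists d.
  by exists 0%N.
pose r := fix r n := if n is m.+1 then b m * r m - (d (b m * r m))%:R else 1.
pose a : digits := fun n => d (b n * r n); exists a.
have remE n : remainder b a n = r n * weight b n.
  elim: n => [|n IH]; first by rewrite remainder0 weight0 mulr1.
  rewrite remainderS IH weightS /a /= mulrBl; congr (_ - _).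
  by field; rewrite gt_eqF.
have Qr n : Q (r n).
  by elim: n => // n IH; apply/PQ/dP/Qmul.
move=> n; rewrite remE mulfK; last by rewrite gt_eqF// weight_gt0.
exact/dP/Qmul.
Qed.

Lemma greedy_digits b : (forall n, 0 < b n) ->
  exists a, forall n, 0 <= remainder b a n.+1 < weight b n.+1.
Proof.
move=> b0; have := @digits_exist b (fun x => 0 <= x) (fun x => 0 <= x < 1) b0.
case=> [x x0|x /andP[]//|c x c0|//|a aP].
- exists (Num.trunc x); have := truncn_itv x0.
  by rewrite subr_ge0 ltrBlDr addrC natr1.
- by move=> x0; rewrite mulr_ge0// ltW.
- exists a => n; have w0 := weight_gt0 b0 n.+1.
  by have := aP n; rewrite ltr_pdivrMr// mul1r pmulr_lge0 ?invr_gt0.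
Qed.

Lemma quasi_greedy_digits b : (forall n, 0 < b n) ->
  exists a, forall n, 0 < remainder b a n.+1 <= weight b n.+1.
Proof.
move=> b0; have := @digits_exist b (fun x => 0 < x) (fun x => 0 < x <= 1) b0.
case=> [x x0|x /andP[]//|c x c0|//|a aP].
(* The largest integer strictly below x, in place of the floor, keeps the remainder positive; it is
   nonnegative since x > 0. *)
- exists `|Num.ceil x - 1|%N.
  have c1 : 1 <= Num.ceil x by rewrite -gtz0_ge1 ceil_gt0.
  have -> : `|Num.ceil x - 1|%N%:R = (Num.ceil x - 1)%:~R :> R.
    by rewrite -[in RHS](@gez0_abs (Num.ceil x - 1)) ?subr_ge0.
  have := ceil_itv x; rewrite rmorphB /= => /andP[? ?]; lra.
- exact: mulr_gt0.
- exists a => n; have w0 := weight_gt0 b0 n.+1.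
  by have := aP n; rewrite ler_pdivrMr// mul1r => /andP[+ ->]; rewrite pmulr_lgt0 ?invr_gt0// => ->.
Qed.

Lemma base_valE B a : base_val B a =
  (\sum_(0 <= j <oo) ((a j)%:R * weight (past B 0) j.+1)%:E)%E.
Proof.
apply: eq_eseriesr => j _; congr ((_ * _)%:E).
rewrite big_add1 /= big_mkord -prodfV; apply: eq_bigr => k _.
by rewrite /past sub0r.
Qed.

Lemma remainder_ge0 B a : (forall i, 0 < B i) -> base_val B a = 1%E ->
  forall n, 0 <= remainder (past B 0) a n.
Proof.
move=> B0 val1 n; rewrite subr_ge0 -lee_fin -val1 base_valE -sumEFin.
rewrite -(big_mkord xpredT
  (fun j => ((a j)%:R * weight (past B 0) j.+1)%:E)).
apply: nneseries_lim_ge => j _ _; rewrite lee_fin mulr_ge0// ltW//.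
by apply: weight_gt0 => k; apply: B0.
Qed.

Lemma base_val_eq1 B a :
  remainder (past B 0) a n @[n --> \oo] --> 0 -> base_val B a = 1%E.
Proof.
move=> r0; rewrite base_valE; apply: cvg_lim => //.
rewrite (_ : (fun n => _) = EFin \o (fun n => 1 - remainder (past B 0) a n)).
  apply: cvg_EFin; first exact: nearW.
  by rewrite -[X in _ --> X]subr0; apply: cvgB => //; exact: cvg_cst.
by apply/funext => n /=; rewrite /remainder subKr sumEFin big_mkord.
Qed.

Lemma tight_base_val B a (c : R) : 1 < c -> (forall i, c <= B i) ->
  tight (past B 0) a -> base_val B a = 1%E.
Proof.
move=> c1 cB ta; apply: base_val_eq1.
apply: (@squeeze_cvgr _ _ _ _ (fun=> 0) (weight (past B 0))).
- by apply: nearW => n; exact: ta.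
- exact: cvg_cst.
- by apply: weight_cvg0 c1 _ => n; apply: cB.
Qed.

Lemma tight_succ b a :
  (forall n, 0 <= remainder b a n.+1 <= weight b n.+1) -> tight b a.
Proof. by move=> ta [|n]//; rewrite remainder0 weight0 ler01 lexx. Qed.

Lemma remainder_excess b t x k : (forall n, 0 < b n) ->
  (forall j, (j < k)%N -> x j = t j) -> (t k < x k)%N ->
  remainder b x k.+1 <= remainder b t k.+1 - weight b k.+1.
Proof.
move=> b0 pre tx; rewrite !remainderS (eq_remainder _ _ t)//.
have := weight_gt0 b0 k.+1.
have : (t k).+1%:R <= (x k)%:R :> R by rewrite ler_nat.
rewrite -natr1; nra.
Qed.

(** A sequence exceeding the constructed one at the first difference spends at least one more full
    weight, which is more than the remainder, so its own remainder becomes negative. *)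
Lemma greedy_tight B (c : R) : 1 < c -> (forall i, c <= B i) ->
  tight (past B 0) (greedy_expansion1 B).
Proof.
move=> c1 cB; have B0 i : 0 < B i.
  by rewrite (lt_le_trans _ (cB i))// (lt_trans _ c1).
have b0 n : 0 < past B 0 n by apply: B0.
have [t tP] := greedy_digits _ b0.
have tt : tight (past B 0) t.
  by apply: tight_succ => n; have /andP[-> /ltW ->] := tP n.
rewrite /greedy_expansion1 (lex_greatest_eq _ t)//=.
  exact: tight_base_val c1 cB tt.
move=> x /= x1; apply: digits_le => k pre; rewrite leqNgt; apply/negP => tx.
have := remainder_excess _ _ _ _ b0 pre tx; have := remainder_ge0 _ _ B0 x1 k.+1.
have /andP[_] := tP k; lra.
Qed.

(** Here the remainder may equal the full weight, so a larger competitor can reach remainder exactly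
    0; all its later digits then vanish, which is excluded. *)
Lemma quasi_greedy_tight B (c : R) : 1 < c -> (forall i, c <= B i) ->
  tight (past B 0) (quasi_greedy_expansion1 B).
Proof.
move=> c1 cB; have B0 i : 0 < B i.
  by rewrite (lt_le_trans _ (cB i))// (lt_trans _ c1).
have b0 n : 0 < past B 0 n by apply: B0.
have [t tP] := quasi_greedy_digits _ b0.
have tt : tight (past B 0) t.
  by apply: tight_succ => n; have /andP[/ltW -> ->] := tP n.
rewrite /quasi_greedy_expansion1 (lex_greatest_eq _ t)//=.
  split; first exact: tight_base_val c1 cB tt.
  move=> [N t0]; have r0 : 0 < remainder (past B 0) t N.
    by case: N {t0} => [|n]; [rewrite remainder0|have /andP[] := tP n].
  have [j Nj] := tight_nonzero_digit c1 (fun n => cB _) t N tt r0.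
  by rewrite t0.
move=> x /= [x1 xN0]; apply: digits_le => k pre; rewrite leqNgt; apply/negP => tx.
have r_le0 : remainder (past B 0) x k.+1 <= 0.
  by rewrite (le_trans (remainder_excess _ _ _ _ b0 pre tx))// subr_le0; have /andP[] := tP k.
apply: xN0; exists k.+1 => j kj; apply/eqP; rewrite -leqn0 leqNgt; apply/negP => xj.
have := remainder_ge0 _ _ B0 x1 j.+1; rewrite remainderS.
have := remainder_le b0 x _ _ kj.
have : 0 < (x j)%:R * weight (past B 0) j.+1.
  by rewrite mulr_gt0 ?ltr0n// weight_gt0.
lra.
Qed.

End Expansions.

Theorem proposition8 (R : realType) (p : nat) (hp : (1 <= p)%N)
    (alpha : R)
    (halpha : root ('X^p - \sum_(i < p) 'X^i : {poly R}) alpha)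
    (halpha12 : 1 <= alpha < 2)
    (B : int -> R) (hB : alternate_base p B)
    (hBalpha : forall i : nat, (i < p)%N -> alpha < B i%:Z) :
  (forall Gamma : int -> R, alternate_base p Gamma ->
     (forall i : nat, (i < p)%N ->
        greedy_expansion1 (base_shift i%:Z Gamma) =
        greedy_expansion1 (base_shift i%:Z B)) ->
     Gamma = B) /\
  (forall Gamma : int -> R, alternate_base p Gamma ->
     (forall i : nat, (i < p)%N ->
        quasi_greedy_expansion1 (base_shift i%:Z Gamma) =
        quasi_greedy_expansion1 (base_shift i%:Z B)) ->
     Gamma = B).
Proof.
have perE (F : int -> R) : alternate_base p F -> forall i, F (i + p%:Z) = F i.
  by move=> [_ Fp] i; rewrite -[RHS](congr1 (@^~ i) Fp).
have alpha0 : 0 < alpha by case/andP: halpha12; lra.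
have aB i : alpha < B i.
  by have [j jp ->] := periodic_ord _ _ _ i hp (perE _ hB); exact: hBalpha.
have onesB := ones_past_lt1 _ _ _ hp halpha alpha0 aB.
(* Of the expansion map [e] only tightness is used, so both claims are instances of one. *)
suff key (e : (int -> R) -> digits) : (forall F (c : R), 1 < c ->
      (forall i, c <= F i) -> tight (past F 0) (e F)) ->
    forall G, alternate_base p G -> (forall i : nat, (i < p)%N ->
      e (base_shift i%:Z G) = e (base_shift i%:Z B)) -> G = B.
  by split; apply: key; [exact: greedy_tight|exact: quasi_greedy_tight].
move=> tight_e G hG eGB.
have gt1 (F : int -> R) : alternate_base p F -> forall i, 1 < F i.
  by move=> [[]].
have tight_shift (F : int -> R) : alternate_base p F ->
    forall i, tight (past F i) (e (base_shift i F)).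
  move=> hF i.
  have [c c1 cF] := periodic_gt1_bounded _ _ hp (perE _ hF) (gt1 _ hF).
  have -> : past F i = past (base_shift i F) 0.
    by apply/funext => n; rewrite /past /base_shift sub0r addrC.
  by apply: tight_e c1 _ => j; exact: cF.
have shift_per (F : int -> R) : alternate_base p F ->
    forall i, base_shift (i + p%:Z) F = base_shift i F.
  by move=> hF i; apply/funext => j; rewrite /base_shift addrA (perE _ hF).
(* Periodicity of the pair of expansions extends the equality from 0, ..., p - 1 to all integers. *)
have eE i : e (base_shift i G) = e (base_shift i B).
  have [] := periodic_ord _ _ (fun i => (e (base_shift i G), e (base_shift i B))) i hp.
    by move=> j; rewrite !shift_per.
  by move=> j jp [-> ->]; exact: eGB.
apply: (tight_family_inj _ _ (fun i => e (base_shift i B)) p) => //.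
- exact: perE.
- exact: perE.
- exact: gt1.
- exact: gt1.
- exact: tight_shift.
- by move=> i; rewrite -eE; exact: tight_shift.
Qed.
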